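(* Let $R$ be an associative ring with $1$ and let $\mathcal K\subseteq \mathrm{Mod}\text{-}R$ and $\mathcal L\subseteq R\text{-}\mathrm{Mod}$ be definably dual classes of modules. A left $R$-module is $\mathcal K$-Mittag-Leffler if and only if it is countably $\mathcal L$-pure separable by countably generated $\mathcal K$-Mittag-Leffler modules.
   Context: A pp formula over left $R$-modules is $\varphi(\bar x)=\exists\bar y\,(A\bar x=B\bar y)$ with $A,B$ matrices over $R$; $\varphi(M)$ is its solution set in $M$. For a class $\mathcal X$ of modules, $\varphi\le_{\mathcal X}\psi$ means $\varphi(X)\subseteq\psi(X)$ for all $X\in\mathcal X$. $\langle\mathcal X\rangle$ is the definable subcategory generated by $\mathcal X$: the class of all modules $C$ such that $\varphi\le_{\mathcal X}\psi$ implies $\varphi(C)\subseteq\psi(C)$, for all pp $\varphi,\psi$. The elementary dual of $\varphi$ is the right pp formula $\mathrm D\varphi(\bar x)=\exists\bar z(\bar x=\bar zA\wedge \bar zB=0)$. Classes $\mathcal K$ of right and $\mathcal L$ of left $R$-modules are definably dual if, for all left pp formulas $\varphi,\psi$: $\varphi\le_{\mathcal L}\psi$ iff $\mathrm D\psi\le_{\mathcal K}\mathrm D\varphi$. A left module $M$ is $\mathcal K$-Mittag-Leffler if the canonical map $(\prod_I N_i)\otimes M\to\prod_I(N_i\otimes M)$ is injective for every family $(N_i)_{i\in I}$ of members of $\mathcal K$. A submodule $N$ of $M$ is $\mathcal L$-pure if $K\otimes N\to K\otimes M$ is injective for all $K\in\langle\mathcal K\rangle$ ($\mathcal K$ definably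 dual to $\mathcal L$). A module $M$ is countably $\mathcal L$-pure separable by modules from a class $\mathcal C$ if every countable subset of $M$ (i.e. of cardinality $<\aleph_1$) is contained in an $\mathcal L$-pure submodule of $M$ that is a member of $\mathcal C$. *)

(* Defs.v *)
From HB Require Import structures.
From mathcomp Require Import all_boot all_order all_algebra all_classical.
From mathcomp Require freeg.

Set Implicit Arguments.
Unset Strict Implicit.
Unset Printing Implicit Defensive.

Import GRing.Theory.
Import freeg.

Local Open Scope classical_set_scope.
Local Open Scope ring_scope.

(* Left R-modules are [lmodType R]; right R-modules are [lmodType R^c], where
   [R^c] is the opposite ring: [x r] is written [(r : R^c) *: x]. *)

(* [PP A B] is the formula  exists y, A x = B y. *)
Record pp (R : pzRingType) (n : nat) := PP {
  pp_rows : nat;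
  pp_bound : nat;
  pp_A : 'M[R]_(pp_rows, n);
  pp_B : 'M[R]_(pp_rows, pp_bound) }.

Definition pp_sol (R : pzRingType) (n : nat) (phi : pp R n) (M : lmodType R) :
    set ('I_n -> M) :=
  [set x | exists y : 'I_(pp_bound phi) -> M, forall i,
     \sum_(j < n) pp_A phi i j *: x j
       = \sum_(j < pp_bound phi) pp_B phi i j *: y j].

Arguments pp_sol {R n} phi M _.

Definition pp_le (R : pzRingType) (X : lmodType R -> Prop) (n : nat)
    (phi psi : pp R n) : Prop :=
  forall M : lmodType R, X M -> pp_sol phi M `<=` pp_sol psi M.

Definition definable_closure (R : pzRingType) (X : lmodType R -> Prop)
    (C : lmodType R) : Prop :=
  forall (n : nat) (phi psi : pp R n),
    pp_le X phi psi -> pp_sol phi C `<=` pp_sol psi C.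

(* exists z, x = z A /\ z B = 0, as the pp formula
   exists z, (x, 0) = z (A, B)  over R^c; see [pp_dual_solE]. *)
Definition pp_dual (R : pzRingType) (n : nat) (phi : pp R n) : pp R^c n :=
  @PP R^c n (n + pp_bound phi) (pp_rows phi)
    (col_mx 1%:M 0) (col_mx (pp_A phi)^T (pp_B phi)^T).

Lemma pp_dual_solE (R : pzRingType) (n : nat) (phi : pp R n)
    (N : lmodType R^c) (x : 'I_n -> N) :
  pp_sol (pp_dual phi) N x <->
  exists z : 'I_(pp_rows phi) -> N,
    (forall j, x j = \sum_i (pp_A phi i j : R^c) *: z i) /\
    (forall j, \sum_i (pp_B phi i j : R^c) *: z i = 0).
Proof.
rewrite /pp_sol /=; split=> [[z zP]|[z [zA zB]]]; exists z.
  split=> j.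
    have := zP (lshift _ j).
    rewrite (bigD1 j) //= col_mxEu mxE eqxx scale1r big1 ?addr0 => [->|i ij].
      by apply: eq_bigr => i _; rewrite col_mxEu mxE.
    by rewrite col_mxEu mxE eq_sym (negPf ij) scale0r.
  have := zP (rshift _ j).
  rewrite big1 => [E|i _]; last by rewrite col_mxEd mxE scale0r.
  by rewrite [RHS]E; apply: eq_bigr => i _; rewrite col_mxEd mxE.
move=> i; case: (split_ordP i) => j ->.
  rewrite (bigD1 j) //= col_mxEu mxE eqxx scale1r big1 ?addr0 => [|k kj].
    by rewrite zA; apply: eq_bigr => k _; rewrite col_mxEu mxE.
  by rewrite col_mxEu mxE eq_sym (negPf kj) scale0r.
rewrite big1 => [|k _]; last by rewrite col_mxEd mxE scale0r.
rewrite -[LHS](zB j); apply: eq_bigr => k _; by rewrite col_mxEd mxE.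
Qed.

Definition definably_dual (R : pzRingType) (K : lmodType R^c -> Prop)
    (L : lmodType R -> Prop) : Prop :=
  forall (n : nat) (phi psi : pp R n),
    pp_le L phi psi <-> pp_le K (pp_dual psi) (pp_dual phi).

Section Product.
Variables (R : pzRingType) (I : Type) (N : I -> lmodType R).

Definition dprod : Type := forall i, N i.

HB.instance Definition _ := gen_eqMixin dprod.
HB.instance Definition _ := gen_choiceMixin dprod.

Let addA : associative (fun x y : dprod => (fun i => x i + y i) : dprod).
Proof. by move=> x y z; apply: functional_extensionality_dep => i; rewrite addrA. Qed.
Let addC : commutative (fun x y : dprod => (fun i => x i + y i) : dprod).
Proof. by move=> x y; apply: functional_extensionality_dep => i; rewrite addrC. Qed.
Let add0 : left_id ((fun i => 0) : dprod)
  (fun x y : dprod => (fun i => x i + y i) : dprod).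
Proof. by move=> x; apply: functional_extensionality_dep => i; rewrite add0r. Qed.
Let addN : left_inverse ((fun i => 0) : dprod)
  (fun x : dprod => (fun i => - x i) : dprod)
  (fun x y : dprod => (fun i => x i + y i) : dprod).
Proof. by move=> x; apply: functional_extensionality_dep => i; rewrite addNr. Qed.
HB.instance Definition _ := GRing.isZmodule.Build dprod addA addC add0 addN.

Let scaleA (a b : R) (x : dprod) :
  (fun i => a *: (b *: x i)) = (fun i => (a * b) *: x i) :> dprod.
Proof. by apply: functional_extensionality_dep => i; rewrite scalerA. Qed.
Let scale1 : left_id 1 (fun (a : R) (x : dprod) => (fun i => a *: x i) : dprod).
Proof. by move=> x; apply: functional_extensionality_dep => i; rewrite scale1r. Qed.
Let scaleDr :
  right_distributive (fun (a : R) (x : dprod) => (fun i => a *: x i) : dprod) +%R.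
Proof. by move=> a x y; apply: functional_extensionality_dep => i; rewrite scalerDr. Qed.
Let scaleDl (x : dprod) :
  {morph (fun (a : R) => (fun i => a *: x i) : dprod) : a b / a + b}.
Proof. by move=> a b; apply: functional_extensionality_dep => i; rewrite scalerDl. Qed.
HB.instance Definition _ :=
  GRing.Zmodule_isLmodule.Build R dprod scaleA scale1 scaleDr scaleDl.

Definition dproj (i : I) (x : dprod) : N i := x i.

End Product.

Section Tensor.
Variables (R : pzRingType) (N : lmodType R^c) (M : lmodType R).

Local Notation gen x y := (<< (x, y) >> : {freeg (N * M)%type / int}).

Definition tensor_rel : set {freeg (N * M)%type / int} :=
  [set t | (exists x x' y, t = gen (x + x') y - gen x y - gen x' y)
        \/ (exists x y y', t = gen x (y + y') - gen x y - gen x y')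
        \/ (exists x (r : R) y, t = gen ((r : R^c) *: x) y - gen x (r *: y))].

Definition tensor_ker : {pred {freeg (N * M)%type / int}} :=
  fun t => `[< forall S : zmodClosed {freeg (N * M)%type / int},
                 (forall u, tensor_rel u -> u \in S) -> t \in S >].

Lemma tensor_ker_closed : zmod_closed tensor_ker.
Proof.
split=> [|u v /asboolP uP /asboolP vP]; apply/asboolP => S SP.
  exact: rpred0.
by rewrite rpredB ?uP ?vP.
Qed.

HB.instance Definition _ :=
  GRing.isZmodClosed.Build {freeg (N * M)%type / int} tensor_ker tensor_ker_closed.

Definition tensor : Type := Quotient.quot tensor_ker.
HB.instance Definition _ := GRing.Zmodule.on tensor.

Definition tens (x : N) (y : M) : tensor :=
  \pi_(Quotient.quot tensor_ker)%qT (gen x y).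

Definition balanced (G : zmodType) (f : N -> M -> G) : Prop :=
  [/\ forall x x' y, f (x + x') y = f x y + f x' y,
      forall x y y', f x (y + y') = f x y + f x y' &
      forall x (r : R) y, f ((r : R^c) *: x) y = f x (r *: y)].

(* The additive map N (x) M -> G induced by [f]; meaningful only for balanced
   [f] (see [tensor_liftE], [tensor_liftB] and [tensor_lift_unique]). *)
Definition tensor_lift (G : zmodType) (f : N -> M -> G) (t : tensor) : G :=
  fglift (fun p : N * M => f p.1 p.2 : zmodule G)
    (repr (t : Quotient.quot tensor_ker)).

Lemma tensor_relP t : tensor_rel t -> t \in tensor_ker.
Proof. by move=> tP; apply/asboolP => S; apply. Qed.

Lemma tensor_piB (u v : {freeg (N * M)%type / int}) :
  (\pi_(Quotient.quot tensor_ker)%qT (u - v) : tensor)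
    = \pi_(Quotient.quot tensor_ker)%qT u - \pi_(Quotient.quot tensor_ker)%qT v.
Proof. by rewrite !piE. Qed.

Lemma tensor_pi0 : (\pi_(Quotient.quot tensor_ker)%qT 0 : tensor) = 0.
Proof. by rewrite -(subrr 0) tensor_piB subrr. Qed.

Lemma tensor_piN (u : {freeg (N * M)%type / int}) :
  (\pi_(Quotient.quot tensor_ker)%qT (- u) : tensor)
    = - \pi_(Quotient.quot tensor_ker)%qT u.
Proof. by rewrite -sub0r tensor_piB tensor_pi0 sub0r. Qed.

Lemma tensor_piD (u v : {freeg (N * M)%type / int}) :
  (\pi_(Quotient.quot tensor_ker)%qT (u + v) : tensor)
    = \pi_(Quotient.quot tensor_ker)%qT u + \pi_(Quotient.quot tensor_ker)%qT v.
Proof. by rewrite -[in LHS](opprK v) tensor_piB tensor_piN opprK. Qed.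

Lemma tensor_piMz (u : {freeg (N * M)%type / int}) (k : int) :
  (\pi_(Quotient.quot tensor_ker)%qT (u *~ k) : tensor)
    = \pi_(Quotient.quot tensor_ker)%qT u *~ k.
Proof.
have piMn m : (\pi_(Quotient.quot tensor_ker)%qT (u *+ m) : tensor)
    = \pi_(Quotient.quot tensor_ker)%qT u *+ m.
  by elim: m => [|m IH]; rewrite ?mulr0n ?tensor_pi0 // !mulrS tensor_piD IH.
by case: k => m; rewrite ?NegzE ?mulrNz ?tensor_piN -?pmulrn piMn.
Qed.

Lemma tensor_pi_ker (u : {freeg (N * M)%type / int}) :
  u \in tensor_ker -> (\pi_(Quotient.quot tensor_ker)%qT u : tensor) = 0.
Proof. by move=> uP; rewrite -tensor_pi0; apply/eqP; rewrite -Quotient.idealrBE subr0. Qed.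

Lemma tens_balanced : balanced tens.
Proof.
split=> [x x' y|x y y'|x r y]; apply/eqP; rewrite -subr_eq0 ?opprD ?addrA /tens
  -!tensor_piB tensor_pi_ker //; apply: tensor_relP.
- by left; exists x, x', y.
- by right; left; exists x, y, y'.
- by right; right; exists x, r, y.
Qed.

Section Lift.
Variables (G : zmodType) (f : N -> M -> G) (f_bal : balanced f).
Let F (u : {freeg (N * M)%type / int}) : zmodule G :=
  fglift (fun p : N * M => f p.1 p.2 : zmodule G) u.

Let FB u v : F (u - v) = F u - F v.
Proof. exact: lift_is_additive. Qed.

Let FU p : F << p >> = f p.1 p.2.
Proof. by rewrite /F liftU scale1r. Qed.

Let kerF : {pred {freeg (N * M)%type / int}} := fun u => F u == 0.
Let kerF_closed : zmod_closed kerF.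
Proof.
split=> [|u v /eqP uP /eqP vP]; rewrite unfold_in /kerF.
  by rewrite -(subrr (0 : {freeg (N * M)%type / int})) FB subrr.
by rewrite FB uP vP subrr.
Qed.
HB.instance Definition _ :=
  GRing.isZmodClosed.Build {freeg (N * M)%type / int} kerF kerF_closed.

Let F_ker u : u \in tensor_ker -> F u = 0.
Proof.
case: f_bal => fDl fDr fZ.
move=> /asboolP /(_ kerF) uP; apply/eqP.
apply: uP => w; case=> [[x [x' [y ->]]]|[[x [y [y' ->]]]|[x [r [y ->]]]]];
  rewrite unfold_in /kerF !FB !FU /=.
- by rewrite fDl [X in X - _]addrAC subrr add0r subrr.
- by rewrite fDr [X in X - _]addrAC subrr add0r subrr.
- by rewrite fZ subrr.
Qed.

Let lift_pi u : tensor_lift f (\pi_(Quotient.quot tensor_ker)%qT u) = F u.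
Proof.
apply/eqP; rewrite -subr_eq0 -[X in X == 0]FB F_ker //.
by rewrite Quotient.idealrBE reprK.
Qed.

Lemma tensor_liftE x y : tensor_lift f (tens x y) = f x y.
Proof. by rewrite /tens lift_pi FU. Qed.

Lemma tensor_liftB : {morph tensor_lift f : s t / s - t}.
Proof.
move=> s t; rewrite -[s]reprK -[t]reprK -tensor_piB !lift_pi; exact: FB.
Qed.

End Lift.

Lemma tensor_ind (P : tensor -> Prop) :
  (forall x y, P (tens x y)) -> (forall s t, P s -> P t -> P (s - t)) ->
  forall t, P t.
Proof.
move=> Ptens PB.
have P0 : P 0 by rewrite -(subrr (tens 0 0)); apply: PB.
have PN t : P t -> P (- t) by rewrite -[- t]sub0r; apply: PB.
have PD s t : P s -> P t -> P (s + t).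
  by move=> Ps Pt; rewrite -[t]opprK; apply/PB/PN.
have PM t (k : int) : P t -> P (t *~ k).
  have PMn m : P t -> P (t *+ m).
    by move=> Pt; elim: m => [|m IH]; rewrite ?mulr0n // mulrS; apply: PD.
  by case: k => m Pt; [apply: PMn|apply/PN/PMn].
move=> t; rewrite -[t]reprK.
elim/freeg_ind_dom0: (repr t) => [|k [x y] u _ _ Pu].
  by rewrite tensor_pi0.
rewrite tensor_piD -[k]intz -freegU_mulz tensor_piMz.
by apply: PD => //; apply: PM; apply: Ptens.
Qed.

Lemma tensor_lift_unique (G : zmodType) (f : N -> M -> G) (g : tensor -> G) :
  balanced f -> {morph g : s t / s - t} ->
  (forall x y, g (tens x y) = f x y) -> g = tensor_lift f.
Proof.
move=> f_bal gB gE; apply/funext; elim/tensor_ind => [x y|s t gs gt].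
  by rewrite gE tensor_liftE.
by rewrite gB tensor_liftB // gs gt.
Qed.

End Tensor.

Definition tensor_map (R : pzRingType) (N N' : lmodType R^c) (M M' : lmodType R)
    (f : {linear N -> N'}) (g : {linear M -> M'}) : tensor N M -> tensor N' M' :=
  tensor_lift (fun x y => tens (f x) (g y)).

(* The canonical map (prod_i N_i) (x) M -> prod_i (N_i (x) M), which sends
   x (x) m to (x_i (x) m)_i. *)
Definition prod_tensor_map (R : pzRingType) (I : Type) (N : I -> lmodType R^c)
    (M : lmodType R) : tensor (dprod N) M -> forall i, tensor (N i) M :=
  fun t i => tensor_lift (fun x m => tens (dproj i x) m) t.

Lemma tensor_map_balanced (R : pzRingType) (N N' : lmodType R^c)
    (M M' : lmodType R) (f : {linear N -> N'}) (g : {linear M -> M'}) :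
  balanced (fun x y => tens (f x) (g y)).
Proof.
have [tDl tDr tZ] := tens_balanced N' M'.
by split=> [x x' y|x y y'|x r y]; rewrite ?linearD ?linearZ ?tDl ?tDr ?tZ.
Qed.

Lemma prod_tensor_map_balanced (R : pzRingType) (I : Type)
    (N : I -> lmodType R^c) (M : lmodType R) (i : I) :
  balanced (fun (x : dprod N) (m : M) => tens (dproj i x) m).
Proof.
have [tDl tDr tZ] := tens_balanced (N i) M.
by split=> [x x' y|x y y'|x r y]; rewrite ?tDr -?tZ -?tDl.
Qed.

Definition mittag_leffler (R : pzRingType) (K : lmodType R^c -> Prop)
    (M : lmodType R) : Prop :=
  forall (I : Type) (N : I -> lmodType R^c),
    (forall i, K (N i)) -> injective (@prod_tensor_map R I N M).

(* The submodule is the subtype [N] of [M] cut out by the predicate [P].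
   Any K dual to L gives the same notion; see [pure_submod_dualE]. *)
Definition pure_submod (R : pzRingType) (L : lmodType R -> Prop)
    (M : lmodType R) (P : {pred M}) (N : subLmodType P) : Prop :=
  forall K : lmodType R^c -> Prop, definably_dual K L ->
  forall X : lmodType R^c, definable_closure K X ->
    injective (tensor_map (idfun : {linear X -> X}) (val : {linear N -> M})).

Lemma pp_dual_surj (R : pzRingType) (n : nat) (sigma : pp R^c n) :
  exists phi : pp R n,
    forall X : lmodType R^c, pp_sol (pp_dual phi) X = pp_sol sigma X.
Proof.
pose phi := @PP R n (n + pp_bound sigma) (pp_rows sigma)
  (col_mx 1%:M 0) (col_mx (pp_A sigma)^T (- (pp_B sigma)^T)).
exists phi => X; apply/seteqP; split=> x.
  move=> /pp_dual_solE[z [zA zB]]; exists (fun k => z (rshift n k)) => i.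
  have zx j : x j = z (lshift _ j).
    rewrite zA /= big_split_ord /= [X in _ + X]big1 ?addr0 => [|k _].
      rewrite (bigD1 j) //= col_mxEu mxE eqxx scale1r big1 ?addr0 // => k kj.
      by rewrite col_mxEu mxE (negPf kj) scale0r.
    by rewrite col_mxEd mxE scale0r.
  apply/eqP; rewrite -subr_eq0 -sumrN -[X in _ == X](zB i).
  rewrite [X in _ == X]big_split_ord /=; apply/eqP.
  congr (_ + _); apply: eq_bigr => j _; first by rewrite col_mxEu mxE zx.
  by rewrite col_mxEd !mxE scaleNr.
move=> [y xy]; apply/pp_dual_solE.
exists (fun i : 'I_(n + pp_bound sigma) =>
  match fintype.split i with inl j => x j | inr k => y k end); split=> j.
  rewrite big_split_ord /= [X in _ + X]big1 ?addr0 => [|k _].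
    rewrite (bigD1 j) //= col_mxEu mxE eqxx scale1r (unsplitK (inl j)).
    rewrite big1 ?addr0 // => k kj.
    by rewrite col_mxEu mxE (negPf kj) scale0r.
  by rewrite col_mxEd mxE scale0r.
rewrite big_split_ord /=; move/eqP: (xy j); rewrite -subr_eq0 -sumrN => /eqP E.
rewrite -[RHS]E; congr (_ + _); apply: eq_bigr => i _.
  by rewrite (unsplitK (inl i)) col_mxEu mxE.
by rewrite (unsplitK (inr i)) col_mxEd !mxE scaleNr.
Qed.

Lemma definable_closure_dual (R : pzRingType) (K K' : lmodType R^c -> Prop)
    (L : lmodType R -> Prop) (X : lmodType R^c) :
  definably_dual K L -> definably_dual K' L ->
  definable_closure K X -> definable_closure K' X.
Proof.
move=> KL K'L KX n sigma tau st.
have [phi phiE] := pp_dual_surj sigma; have [psi psiE] := pp_dual_surj tau.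
have /K'L /KL ts : pp_le K' (pp_dual phi) (pp_dual psi).
  by move=> Y K'Y; rewrite phiE psiE; apply: st.
by have := KX _ _ _ ts; rewrite phiE psiE.
Qed.

Lemma pure_submod_dualE (R : pzRingType) (K : lmodType R^c -> Prop)
    (L : lmodType R -> Prop) (M : lmodType R) (P : {pred M})
    (N : subLmodType P) : definably_dual K L ->
  pure_submod L N <->
  forall X : lmodType R^c, definable_closure K X ->
    injective (tensor_map (idfun : {linear X -> X}) (val : {linear N -> M})).
Proof.
move=> KL; split=> [NP|NP K' K'L] X KX; first exact: (NP K).
by apply/NP/(definable_closure_dual K'L KL KX).
Qed.

Definition countably_generated (R : pzRingType) (M : lmodType R) : Prop :=
  exists A : set M, countable A /\
    forall x : M, exists s : seq (R * M),
      (forall p, p \in s -> A p.2) /\ x = \sum_(p <- s) p.1 *: p.2.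

Definition countably_pure_separable (R : pzRingType) (L C : lmodType R -> Prop)
    (M : lmodType R) : Prop :=
  forall A : set M, countable A ->
    exists (P : {pred M}) (N : subLmodType P),
      [/\ forall x, A x -> x \in P, pure_submod L N & C N].

(* Main.v *)
(* A sum of tensors x_j (x) a_j vanishes in X (x) M iff some pp formula phi
   satisfies phi(a) in M and D phi(x) in X.  Hence, if M is K-Mittag-Leffler,
   the pp type of every finite tuple of M contains a formula that is L-smallest
   in it.  Close a countable subset of M under witnesses of these formulas: in
   the submodule spanned by the (still countable) closure, each finite tuple of
   generators satisfies its L-smallest formula, so the vanishing criterion makes
   this submodule L-pure, and an L-pure submodule of a K-Mittag-Leffler module
   is K-Mittag-Leffler.  Conversely, a tensor over a product of members of K
   involves finitely many elements of M, so it lives over one of the separating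
   submodules, whose purity lets the vanishing of coordinates be tested there. *)
Require Import Defs.
From HB Require Import structures.
From mathcomp Require Import all_boot all_order all_algebra all_classical.
From mathcomp Require freeg.

Set Implicit Arguments.
Unset Strict Implicit.
Unset Printing Implicit Defensive.

Import GRing.Theory freeg.

Local Open Scope classical_set_scope.
Local Open Scope ring_scope.

(** * Calculus of elementary tensors *)

Section TensorFacts.
Variables (R : pzRingType) (N : lmodType R^c) (M : lmodType R).

Lemma tensDl (x x' : N) (y : M) : tens (x + x') y = tens x y + tens x' y.
Proof. by have [] := tens_balanced N M. Qed.

Lemma tensDr (x : N) (y y' : M) : tens x (y + y') = tens x y + tens x y'.
Proof. by have [] := tens_balanced N M. Qed.

Lemma tensZ (x : N) (r : R) (y : M) : tens ((r : R^c) *: x) y = tens x (r *: y).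
Proof. by have [] := tens_balanced N M. Qed.

Lemma tens0l (y : M) : tens (0 : N) y = 0.
Proof. by apply: (@addrI _ (tens (0 : N) y)); rewrite -tensDl !addr0. Qed.

Lemma tens0r (x : N) : tens x (0 : M) = 0.
Proof. by apply: (@addrI _ (tens x (0 : M))); rewrite -tensDr !addr0. Qed.

Lemma tensNl (x : N) (y : M) : tens (- x) y = - tens x y.
Proof. by apply: (@addrI _ (tens x y)); rewrite -tensDl !subrr tens0l. Qed.

Lemma tens_suml I (s : seq I) (F : I -> N) (y : M) :
  tens (\sum_(i <- s) F i) y = \sum_(i <- s) tens (F i) y.
Proof.
elim: s => [|i s IH]; first by rewrite !big_nil tens0l.
by rewrite !big_cons tensDl IH.
Qed.

Lemma tens_sumr I (s : seq I) (x : N) (F : I -> M) :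
  tens x (\sum_(i <- s) F i) = \sum_(i <- s) tens x (F i).
Proof.
elim: s => [|i s IH]; first by rewrite !big_nil tens0r.
by rewrite !big_cons tensDr IH.
Qed.

(** Scalars and signs are absorbed into the left entries, so the right entries can be kept in a
    generating set. *)
Lemma tensor_sum_tens (P : M -> Prop) :
  (forall y : M, exists s : seq (R * M),
     (forall p, p \in s -> P p.2) /\ y = \sum_(p <- s) p.1 *: p.2) ->
  forall t : tensor N M, exists s : seq (N * M),
    (forall p, p \in s -> P p.2) /\ t = \sum_(p <- s) tens p.1 p.2.
Proof.
move=> genP; apply: tensor_ind => [x y|t t' [s [sP ->]] [s' [sP' ->]]].
  have [s [sP ->]] := genP y.
  exists [seq ((p.1 : R^c) *: x, p.2) | p <- s]; split.
    by move=> _ /mapP[p ps ->]; exact: sP.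
  by rewrite big_map tens_sumr; apply: eq_bigr => p _; rewrite tensZ.
exists (s ++ [seq (- p.1, p.2) | p <- s']); split.
  move=> p; rewrite mem_cat => /orP[/sP //|/mapP[q qs ->]]; exact: (sP' q qs).
rewrite big_cat big_map -sumrN; congr (_ + _).
by apply: eq_bigr => p _; rewrite tensNl.
Qed.

End TensorFacts.

(** * Additive maps and the vanishing criterion for sums of tensors *)

Lemma morphB_sum (U V : zmodType) (f : U -> V) : {morph f : s t / s - t} ->
  forall I (s : seq I) (F : I -> U), f (\sum_(i <- s) F i) = \sum_(i <- s) f (F i).
Proof.
move=> fB; have f0 : f 0 = 0 by rewrite -(subrr 0) fB subrr.
move=> I s F; elim: s => [|i s IH]; first by rewrite !big_nil.
by rewrite !big_cons -[\sum_(_ <- s) F _]opprK fB -[- \sum_(_ <- s) F _]sub0r fB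
  f0 sub0r opprK IH.
Qed.

Lemma morphB_inj (U V : zmodType) (f : U -> V) : {morph f : s t / s - t} ->
  (forall t, f t = 0 -> t = 0) -> injective f.
Proof.
move=> fB f0 s t E; apply/eqP; rewrite -subr_eq0; apply/eqP/f0.
by rewrite fB E subrr.
Qed.

Lemma sum_iverson (R : pzRingType) (V : lmodType R) (T : eqType) (a : T)
    (E : seq T) (c : T -> V) : uniq E -> a \in E ->
  \sum_(e <- E) (a == e)%:R *: c e = c a.
Proof.
move=> Eu aE; rewrite (bigD1_seq a) //= eqxx scale1r big1 ?addr0 // => e.
by rewrite eq_sym => /negPf->; rewrite scale0r.
Qed.

(* Presenting [M] as the free module on its elements modulo the linear relations
   identifies the tensor product with the finitely supported functions
   [M -> N] modulo the [x * kappa], [kappa] a relation; [relation_span u] says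
   that [u] is zero there. *)
Section VanishingSums.
Variables (R : pzRingType) (N : lmodType R^c) (M : lmodType R).

Definition free_coord (e : M) (u : {freeg (N * M)%type / int}) : zmodule N :=
  fglift ((fun p => if p.2 == e then p.1 else 0) : N * M -> zmodule N) u.

Lemma free_coordB e : {morph free_coord e : u v / u - v}.
Proof. exact: lift_is_additive. Qed.

Lemma free_coordU e p : free_coord e << p >> = if p.2 == e then p.1 else 0.
Proof. by rewrite /free_coord liftU scale1r. Qed.

(** A sum, because [s] may list an element of [M] repeatedly. *)
Definition rel_coef (s : seq (R * M)) (e : M) : R :=
  \sum_(p <- s) p.1 *+ (p.2 == e).

Definition relation_span : {pred {freeg (N * M)%type / int}} := fun u =>
  `[< exists l : seq (N * seq (R * M)),
    (forall q, q \in l -> \sum_(p <- q.2) p.1 *: p.2 = 0) /\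
    forall e, free_coord e u
      = \sum_(q <- l) (rel_coef q.2 e : R^c) *: q.1 :> N >].

Lemma relation_span_closed : zmod_closed relation_span.
Proof.
split=> [|u v /asboolP[l [lP lE]] /asboolP[k [kP kE]]]; apply/asboolP.
  by exists [::]; split=> // e; rewrite big_nil -(subrr 0) free_coordB subrr.
exists (l ++ [seq (- q.1, q.2) | q <- k]); split.
  by move=> q; rewrite mem_cat => /orP[/lP //|/mapP[q' /kP ? ->]].
move=> e; rewrite free_coordB lE kE big_cat big_map -sumrN; congr (_ + _).
by apply: eq_bigr => q _; rewrite scalerN.
Qed.

HB.instance Definition _ :=
  GRing.isZmodClosed.Build {freeg (N * M)%type / int} relation_span
    relation_span_closed.

(** Left additivity already holds for functions; each of the other two cases uses one relation of
    [M], namely [(y + y') - y - y' = 0] or [r y - (r y) = 0]. *)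
Lemma tensor_rel_span u : tensor_rel u -> u \in relation_span.
Proof.
move=> uP; apply/asboolP.
case: uP => [[x [x' [y ->]]]|[[x [y [y' ->]]]|[x [r [y ->]]]]].
- exists [::]; split=> // e; rewrite big_nil !free_coordB !free_coordU /=.
  by case: eqP => _; rewrite ?subrr // addrAC addrK subrr.
- exists [:: (x, [:: (1, y + y'); (-1, y); (-1, y')])]; split=> [q|e].
    rewrite inE => /eqP->; rewrite !big_cons big_nil /= scale1r !scaleN1r.
    by rewrite addr0 -opprD subrr.
  rewrite big_seq1 /rel_coef !big_cons big_nil !free_coordB !free_coordU /= addr0.
  by case: eqP => _; case: eqP => _; case: eqP => _;
    rewrite ?mulr1n ?mulr0n ?scalerDl ?scaleN1r ?scale1r ?scale0r ?subr0 ?add0r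
      ?addr0 ?addrA.
- exists [:: (x, [:: (r, y); (-1, r *: y)])]; split=> [q|e].
    by rewrite inE => /eqP->; rewrite !big_cons big_nil /= scaleN1r addr0 subrr.
  rewrite big_seq1 /rel_coef !big_cons big_nil !free_coordB !free_coordU /= addr0.
  by case: eqP => _; case: eqP => _;
    rewrite ?mulr1n ?mulr0n ?scalerDl ?scaleN1r ?scale1r ?scale0r ?subr0 ?add0r
      ?addr0 ?addrA.
Qed.

End VanishingSums.

Lemma sum_rel_coef (R : pzRingType) (M : lmodType R) (s : seq (R * M))
    (E : seq M) : uniq E -> {subset [seq p.2 | p <- s] <= E} ->
  \sum_(e <- E) rel_coef s e *: e = \sum_(p <- s) p.1 *: p.2.
Proof.
move=> Eu sE; under eq_bigr do rewrite /rel_coef scaler_suml.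
rewrite exchange_big /= !big_seq; apply: eq_bigr => p ps.
rewrite -(@sum_iverson _ _ _ p.2 E (fun e => p.1 *: e)) //; last first.
  exact/sE/map_f.
apply: eq_bigr => e _.
by case: eqP; rewrite ?mulr1n ?mulr0n ?scale1r ?scale0r.
Qed.

(** From right to left, moving scalars across the tensor sign leads from [z A] against [a] to [z B]
    against [y], which is zero. Conversely, the finitely many relations of [M] that make the sum
    vanish are assembled into a formula. *)
Lemma tensor_sum_eq0P (R : pzRingType) (X : lmodType R^c) (M : lmodType R) n
    (x : 'I_n -> X) (a : 'I_n -> M) :
  \sum_j tens (x j) (a j) = 0 <->
  exists phi : pp R n, pp_sol phi M a /\ pp_sol (pp_dual phi) X x.
Proof.
split=> [xa0|[phi [[y yP] /pp_dual_solE[z [zA zB]]]]]; last first.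
  under eq_bigr do rewrite zA tens_suml.
  rewrite exchange_big /=; under eq_bigr do
    (under eq_bigr do rewrite tensZ); under eq_bigr do
    rewrite -tens_sumr yP tens_sumr.
  rewrite exchange_big /= big1 // => k _.
  by under eq_bigr do rewrite -tensZ; rewrite -tens_suml zB tens0l.
pose u : {freeg (X * M)%type / int} := \sum_j << (x j, a j) >>.
have : u \in @relation_span R X M.
  (* [tensor_ker] is the least subgroup containing [tensor_rel], and [relation_span] is another such
     subgroup. *)
  have : u \in @tensor_ker R X M.
    rewrite -[u]subr0 Quotient.idealrBE; apply/eqP.
    rewrite [RHS]tensor_pi0 -[RHS]xa0.
    exact: (morphB_sum (@tensor_piB R X M)).
  by move=> /asboolP; apply; apply: tensor_rel_span.
move=> /asboolP[l [l0 lE]].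
(* Every element of [M] that is some [a j] or occurs in a relation, listed once: each is the value
   of one bound variable. *)
pose E := undup (codom a ++ flatten [seq [seq p.2 | p <- q.2] | q <- l]).
have Eu : uniq E by exact: undup_uniq.
pose e (k : 'I_(size E)) := nth 0 E k.
pose rel (i : 'I_(size l)) := nth (0, [::]) l i.
(* [phi(v)] says that each [v j] equals the bound variable standing for [a j], and that the bound
   variables satisfy the relations in [l]. *)
pose phi := @PP R n (n + size l) (size E) (col_mx 1%:M 0)
  (col_mx (\matrix_(j, k) (a j == e k)%:R)
          (\matrix_(i, k) rel_coef (rel i).2 (e k))).
have sumE (V : zmodType) (F : M -> V) : \sum_k F (e k) = \sum_(m <- E) F m.
  by rewrite (big_nth 0) big_mkord.
have suml (V : zmodType) (F : _ -> V) : \sum_i F (rel i) = \sum_(q <- l) F q.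
  by rewrite (big_nth (0, [::])) big_mkord.
exists phi; split.
  exists e => i; case: (split_ordP i) => j ->.
    rewrite (bigD1 j) //= col_mxEu mxE eqxx scale1r big1 ?addr0; last first.
      by move=> k kj; rewrite col_mxEu mxE eq_sym (negPf kj) scale0r.
    under eq_bigr do rewrite col_mxEu mxE.
    rewrite (sumE _ (fun m => (a j == m)%:R *: m)) sum_iverson //.
    by rewrite mem_undup mem_cat codom_f.
  rewrite big1 => [|k _]; last by rewrite col_mxEd mxE scale0r.
  under eq_bigr do rewrite col_mxEd mxE.
  rewrite (sumE _ (fun m => rel_coef (rel j).2 m *: m)) sum_rel_coef //.
    by rewrite l0 // mem_nth.
  move=> m mj; rewrite mem_undup mem_cat; apply/orP; right.
  apply/flattenP; exists [seq p.2 | p <- (rel j).2] => //.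
  apply: (map_f (fun q : X * seq (R * M) => [seq p.2 | p <- q.2])).
  exact: mem_nth.
apply/pp_dual_solE.
(* With the negated multipliers of the relations in the second block, [z B = 0] becomes, column by
   column, [lE] at the elements of [E]. *)
exists (fun i : 'I_(n + size l) =>
  match fintype.split i with inl j => x j | inr k => - (rel k).1 end).
split=> j; rewrite big_split_ord /=.
  rewrite (bigD1 j) //= col_mxEu mxE eqxx scale1r (unsplitK (inl j)).
  rewrite big1 => [|k kj]; last by rewrite col_mxEu mxE (negPf kj) scale0r.
  by rewrite big1 ?addr0 // => k _; rewrite col_mxEd mxE scale0r.
under eq_bigr do rewrite (unsplitK (inl _)) col_mxEu mxE.
under [X in _ + X]eq_bigr do rewrite (unsplitK (inr _)) col_mxEd mxE scalerN.
rewrite sumrN (suml _ (fun q => (rel_coef q.2 (e j) : R^c) *: q.1)) -lE.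
rewrite /u (morphB_sum (free_coordB _)).
apply/eqP; rewrite subr_eq0; apply/eqP; apply: eq_bigr => i _.
by rewrite free_coordU /=; case: eqP; rewrite ?scale1r ?scale0r.
Qed.

(** * Products and generators of pp types *)

Section MittagLefflerGenerators.
Variables (R : pzRingType) (K : lmodType R^c -> Prop) (M : lmodType R).

Lemma prod_tensor_mapB I (N : I -> lmodType R^c) i :
  {morph (fun t : tensor (dprod N) M => prod_tensor_map t i) : s t / s - t}.
Proof. by move=> s t; apply: (tensor_liftB (prod_tensor_map_balanced N M i)). Qed.

Lemma prod_tensor_map_tens I (N : I -> lmodType R^c) (x : dprod N) (m : M) i :
  prod_tensor_map (tens x m) i = tens (dproj i x) m.
Proof. exact: (tensor_liftE (prod_tensor_map_balanced N M i)). Qed.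

Lemma mittag_lefflerP : mittag_leffler K M <->
  forall I (N : I -> lmodType R^c), (forall i, K (N i)) ->
  forall t : tensor (dprod N) M, (forall i, prod_tensor_map t i = 0) -> t = 0.
Proof.
split=> ML I N KN.
  move=> t t0; apply: (ML I N KN); apply: functional_extensionality_dep => i.
  by rewrite t0 -[X in prod_tensor_map X i](subrr 0) prod_tensor_mapB subrr.
move=> s t st; apply/eqP; rewrite -subr_eq0; apply/eqP/(ML I N KN) => i.
by rewrite prod_tensor_mapB st subrr.
Qed.

Lemma dprod_sum I (N : I -> lmodType R^c) J (s : seq J) (F : J -> dprod N) i :
  dproj i (\sum_(j <- s) F j) = \sum_(j <- s) dproj i (F j).
Proof. by elim: s => [|j s IH]; rewrite ?big_nil // !big_cons -IH. Qed.

(** Equations in a product are read coordinatewise, and choice collects the witnesses of the factors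
    into one. *)
Lemma pp_sol_dprod I (N : I -> lmodType R^c) n (phi : pp R^c n)
    (x : 'I_n -> dprod N) :
  pp_sol phi (dprod N) x <-> forall i, pp_sol phi (N i) (dproj i \o x).
Proof.
split=> [[y yP] i|xP].
  exists (dproj i \o y) => k.
  by have := congr1 (dproj i) (yP k); rewrite !dprod_sum.
exists (fun k i => sval (cid (xP i)) k) => k.
apply: functional_extensionality_dep => i.
apply: (eq_trans (dprod_sum _ _ i)); apply: esym.
apply: (eq_trans (dprod_sum _ _ i)); apply: esym.
exact: svalP (cid (xP i)) k.
Qed.

Lemma definable_closure_dprod I (N : I -> lmodType R^c) :
  (forall i, K (N i)) -> definable_closure K (dprod N).
Proof.
move=> KN n phi psi le x /pp_sol_dprod xP; apply/pp_sol_dprod => i.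
exact/(le _ (KN i))/xP.
Qed.

(* For every pair (phi, psi) with D psi not below D phi on K, take a
   counterexample in a member of K; the product of all these is a tuple whose
   tensor with [a] dies in every factor, hence is zero, and the formula phi
   witnessing this cannot occur in a bad pair. *)
Lemma mittag_leffler_pp_generator n (a : 'I_n -> M) : mittag_leffler K M ->
  exists phi : pp R n, pp_sol phi M a /\
    forall psi : pp R n, pp_sol psi M a -> pp_le K (pp_dual psi) (pp_dual phi).
Proof.
move=> /mittag_lefflerP ML.
pose bad (w : pp R n * pp R n) :=
  pp_sol w.2 M a /\ ~ pp_le K (pp_dual w.2) (pp_dual w.1).
have badP (w : {w | bad w}) : exists Nx : {N : lmodType R^c & 'I_n -> N},
    [/\ K (projT1 Nx), pp_sol (pp_dual (sval w).2) _ (projT2 Nx) &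
        ~ pp_sol (pp_dual (sval w).1) _ (projT2 Nx)].
  case: w => -[phi psi] [_ /=] /existsNP[N] /not_implyP[KN] /existsNP[x].
  by move=> /not_implyP[? ?]; exists (existT _ N x).
have [f fP] := choice badP.
pose N w := projT1 (f w).
pose x j : dprod N := fun w => projT2 (f w) j.
have : \sum_j tens (x j) (a j) = 0.
  apply: ML => [w|w]; first by have [] := fP w.
  rewrite (morphB_sum (@prod_tensor_mapB _ N w)).
  under eq_bigr do rewrite prod_tensor_map_tens.
  apply/tensor_sum_eq0P; exists (sval w).2; split.
    by have [] := svalP w.
  by have [] := fP w.
move=> /tensor_sum_eq0P[phi [phia /pp_sol_dprod phix]].
exists phi; split=> // psi psia; apply: contrapT => nle.
pose w : {w | bad w} := exist _ (phi, psi) (conj psia nle).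
by have [_ _] := fP w; apply; apply: phix.
Qed.

End MittagLefflerGenerators.

(** * Countable closures *)

Lemma countable_range T (A : set T) (x0 : T) : countable A ->
  exists f : nat -> T, A `<=` range f.
Proof.
move=> /countable_injP[g g_inj].
have fP k : exists y, forall x, A x -> g x = k -> y = x.
  have [[x [Ax <-]]|no] := pselect (exists x, A x /\ g x = k).
    by exists x => x' Ax' E; apply: g_inj; rewrite ?inE.
  by exists x0 => x Ax E; case: no; exists x.
have [f fE] := choice fP.
by exists f => x Ax; exists (g x) => //; apply: fE.
Qed.

(** Trees are formal terms: a leaf names a starting element, a node one entry of [F] on the values
    of its children. There are countably many trees, so the closure is countable without building it
    in stages. *)
Fixpoint closure_eval T (x0 : T) (f : nat -> T) (F : seq T -> seq T)
    (t : GenTree.tree nat) : T :=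
  match t with
  | GenTree.Leaf i => f i
  | GenTree.Node k ts => nth x0 (F (map (closure_eval x0 f F) ts)) k
  end.

Lemma countable_finitary_closure (T : eqType) (x0 : T) (F : seq T -> seq T)
    (A : set T) : countable A ->
  exists B : set T, [/\ countable B, A `<=` B &
    forall s, (forall x, x \in s -> B x) -> forall x, x \in F s -> B x].
Proof.
move=> /(countable_range x0)[f Af].
exists (range (closure_eval x0 f F)); split.
- apply/(sub_countable (card_image_le _ _)); exact: countableP.
- by move=> x /Af[i _ <-]; exists (GenTree.Leaf i).
move=> s sB x xF.
have [ts E] : exists ts, map (closure_eval x0 f F) ts = s.
  elim: s sB {xF} => [|y s IH] sB; first by exists [::].
  have [ts E] : exists ts, map (closure_eval x0 f F) ts = s.
    by apply: IH => z zs; apply: sB; rewrite inE zs orbT.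
  have [t _ yE] := sB y (mem_head _ _).
  by exists (t :: ts); rewrite /= E yE.
by exists (GenTree.Node (index x (F s)) ts); rewrite //= E nth_index.
Qed.

(** * The submodule spanned by a set *)

Section Span.
Variables (R : pzRingType) (M : lmodType R) (B : set M).

Definition span : {pred M} := fun x => `[< exists s : seq (R * M),
  (forall p, p \in s -> B p.2) /\ x = \sum_(p <- s) p.1 *: p.2 >].

Lemma span_closed : submod_closed span.
Proof.
split; first by apply/asboolP; exists [::]; rewrite big_nil.
move=> r _ _ /asboolP[s [sB ->]] /asboolP[s' [s'B ->]]; apply/asboolP.
exists ([seq (r * p.1, p.2) | p <- s] ++ s'); split.
  by move=> p; rewrite mem_cat => /orP[/mapP[q /sB ? ->]|/s'B].
rewrite big_cat big_map scaler_sumr; congr (_ + _).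
by apply: eq_bigr => p _; rewrite scalerA.
Qed.

HB.instance Definition _ := GRing.isSubmodClosed.Build R M span span_closed.

Definition span_mod : Type := {x : M | x \in span}.
HB.instance Definition _ := Choice.on span_mod.
HB.instance Definition _ := SubChoice.on span_mod.
HB.instance Definition _ := [SubChoice_isSubLmodule of span_mod by <:].

Lemma mem_span x : B x -> x \in span.
Proof.
move=> Bx; apply/asboolP; exists [:: (1, x)].
rewrite big_seq1 scale1r; split=> //.
by move=> p; rewrite inE => /eqP->.
Qed.

Lemma span_mod_gen (y : span_mod) : exists s : seq (R * span_mod),
  (forall p, p \in s -> B (val p.2)) /\ y = \sum_(p <- s) p.1 *: p.2.
Proof.
have /asboolP[s [sB yE]] := valP y.
(* The default [0] is never taken: the right entries of [s] lie in [B], hence in the span. *)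
exists [seq (p.1, insubd (0 : span_mod) p.2) | p <- s].
have vE p : p \in s -> val (insubd (0 : span_mod) p.2) = p.2.
  by move=> /sB /mem_span pB; rewrite insubdK.
split; first by move=> _ /mapP[p ps ->] /=; rewrite vE //; exact: sB.
apply: val_inj; rewrite yE big_map raddf_sum !big_seq; apply: eq_bigr => p ps.
rewrite -{1}(vE p ps).
exact: esym (linearZ_LR (val : {linear span_mod -> M}) _ _).
Qed.

Lemma span_mod_countably_generated :
  countable B -> countably_generated span_mod.
Proof.
move=> Bc; exists [set y : span_mod | B (val y)]; split; last exact: span_mod_gen.
move: Bc => /countable_injP[g g_inj]; apply/countable_injP.
exists (g \o val) => y z; rewrite !inE => By Bz /= E; apply: val_inj.
by apply: g_inj; rewrite ?inE.
Qed.

End Span.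

(** * Naturality, purity and the two implications *)

Section TensorMap.
Variables (R : pzRingType) (X X' : lmodType R^c) (M M' : lmodType R).
Variables (f : {linear X -> X'}) (g : {linear M -> M'}).

Lemma tensor_mapB : {morph tensor_map f g : s t / s - t}.
Proof. exact: (tensor_liftB (tensor_map_balanced f g)). Qed.

Lemma tensor_map_tens x y : tensor_map f g (tens x y) = tens (f x) (g y).
Proof. exact: (tensor_liftE (tensor_map_balanced f g)). Qed.

Lemma tensor_map0 : tensor_map f g 0 = 0.
Proof. by rewrite -(subrr 0) tensor_mapB subrr. Qed.

End TensorMap.

Lemma prod_tensor_map_natural (R : pzRingType) I (N : I -> lmodType R^c)
    (M M' : lmodType R) (g : {linear M -> M'}) (t : tensor (dprod N) M) i :
  prod_tensor_map (tensor_map (idfun : {linear dprod N -> dprod N}) g t) i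
  = tensor_map (idfun : {linear N i -> N i}) g (prod_tensor_map t i).
Proof.
elim/tensor_ind: t => [x y|s t sE tE].
  by rewrite tensor_map_tens !prod_tensor_map_tens tensor_map_tens.
by rewrite tensor_mapB !prod_tensor_mapB tensor_mapB sE tE.
Qed.

Section Purity.
Variables (R : pzRingType) (K : lmodType R^c -> Prop) (L : lmodType R -> Prop).
Hypothesis KL : definably_dual K L.
Variable M : lmodType R.

(** The image of [t] over [M] has zero coordinates by naturality, so it vanishes; purity at the
    product, which lies in the definable closure of [K], pulls this back to [t]. *)
Lemma pure_submod_mittag_leffler (P : {pred M}) (N : subLmodType P) :
  pure_submod L N -> mittag_leffler K M -> mittag_leffler K N.
Proof.
move=> /(pure_submod_dualE _ KL) Npure /mittag_lefflerP ML.
apply/mittag_lefflerP => I X KX t t0.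
apply: (Npure _ (definable_closure_dprod KX)); rewrite tensor_map0.
by apply: (ML I X KX) => i; rewrite prod_tensor_map_natural t0 tensor_map0.
Qed.

(** If a sum vanishes over [M] through [psi], the inequality from [D psi] to [D phi] passes from [K]
    to [X]. Since [phi] has its witnesses in [B], the sum then vanishes over the span. *)
Lemma span_pure (B : set M) :
  (forall s : seq M, (forall x, x \in s -> B x) -> exists phi : pp R (size s),
    (exists y, (forall k, B (y k)) /\ forall i,
      \sum_j pp_A phi i j *: s`_j = \sum_k pp_B phi i k *: y k) /\
    forall psi : pp R (size s), pp_sol psi M (fun j => s`_j) ->
      pp_le K (pp_dual psi) (pp_dual phi)) ->
  pure_submod L (span_mod B).
Proof.
move=> Bgen; apply/(pure_submod_dualE _ KL) => X KX.
apply: (morphB_inj (@tensor_mapB _ _ _ _ _ _ _)) => t.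
have [s [sB ->]] := tensor_sum_tens
  (P := fun y : span_mod B => B (val y)) (@span_mod_gen _ _ B) t.
rewrite (morphB_sum (@tensor_mapB _ _ _ _ _ _ _)).
under eq_bigr do rewrite tensor_map_tens /=.
pose u := [seq val p.2 | p <- s].
have uE (j : 'I_(size u)) : u`_j = val (nth (0, 0) s j).2.
  by rewrite (nth_map (0, 0)) // -(size_map (fun p => val p.2) s).
rewrite !(big_nth (0, 0)) -(size_map (fun p : X * span_mod B => val p.2) s).
rewrite !big_mkord -/u.
under eq_bigr do rewrite -uE.
have uB x : x \in u -> B x by move=> /mapP[p ps ->]; exact: sB.
have [phi [[y [yB yE]] phi_gen]] := Bgen u uB.
move=> /tensor_sum_eq0P[psi [psiu psix]].
apply/tensor_sum_eq0P; exists phi; split; last exact: (KX _ _ _ (phi_gen _ psiu)).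
exists (fun k => insubd (0 : span_mod B) (y k)) => i; apply: val_inj.
rewrite !raddf_sum; have := yE i.
under eq_bigr do rewrite uE; move=> E; apply: (etrans _ (etrans E _)).
  by apply: eq_bigr => j _; apply: (linearZ_LR (val : {linear span_mod B -> M})).
apply: eq_bigr => k _.
rewrite -{1}(insubdK (0 : span_mod B) (mem_span (yB k))).
exact: esym (linearZ_LR (val : {linear span_mod B -> M}) _ _).
Qed.

Lemma pure_separable_mittag_leffler (C : lmodType R -> Prop) :
  (forall N, C N -> mittag_leffler K N) ->
  countably_pure_separable L C M -> mittag_leffler K M.
Proof.
move=> CML sep; apply/mittag_lefflerP => I X KX t t0.
have [s [_ sE]] : exists s : seq (dprod X * M),
    (forall p, p \in s -> True) /\ t = \sum_(p <- s) tens p.1 p.2.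
  apply: (tensor_sum_tens (P := fun=> True)) => y.
  by exists [:: (1, y)]; rewrite big_seq1 scale1r.
have [|P [N [sN Npure CN]]] := sep [set` [seq p.2 | p <- s]].
  exact/finite_set_countable.
have [t' tE] : exists t' : tensor (dprod X) N,
    t = tensor_map (idfun : {linear dprod X -> dprod X})
          (val : {linear N -> M}) t'.
  (* All right entries of [s] lie in [N], so [insubd] returns the entries themselves. *)
  exists (\sum_(p <- s) tens p.1 (insubd (0 : N) p.2)).
  rewrite sE (morphB_sum (@tensor_mapB _ _ _ _ _ _ _)) !big_seq.
  apply: eq_bigr => p ps; rewrite tensor_map_tens /= insubdK //.
  by apply: sN; rewrite /= map_f.
suff t'0 : t' = 0 by rewrite tE t'0 tensor_map0.
have /mittag_lefflerP := CML N CN; apply => // i.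
(* Purity is applied at each single factor, not at the product. *)
have XiK : definable_closure K (X i) by move=> n phi psi le; exact: le.
apply: ((pure_submod_dualE _ KL).1 Npure _ XiK).
by rewrite -prod_tensor_map_natural -tE t0 tensor_map0.
Qed.

Lemma mittag_leffler_pure_separable : mittag_leffler K M ->
  countably_pure_separable L
    (fun N : lmodType R => countably_generated N /\ mittag_leffler K N) M.
Proof.
move=> ML A Ac.
have gen (s : seq M) :=
  mittag_leffler_pp_generator (fun j : 'I_(size s) => s`_j) ML.
pose phi s := sval (cid (gen s)); have phiP s := svalP (cid (gen s)).
(* The operation sends a tuple to chosen witnesses in [M] of its generating formula. *)
have [B [Bc AB FB]] := countable_finitary_closure 0
  (fun s => codom (sval (cid (phiP s).1))) Ac.
have Bpure : pure_submod L (span_mod B).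
  apply: span_pure => s sB; exists (phi s); split; last exact: (phiP s).2.
  exists (sval (cid (phiP s).1)); split.
    by move=> k; apply: FB sB _ _; apply: codom_f.
  exact: svalP (cid (phiP s).1).
exists (span B), (span_mod B); split => //.
  by move=> x /AB; exact: mem_span.
split; first exact: span_mod_countably_generated.
exact: pure_submod_mittag_leffler Bpure ML.
Qed.

End Purity.

Theorem corollary6p5 (R : pzRingType) (K : lmodType R^c -> Prop)
    (L : lmodType R -> Prop) (KL : definably_dual K L) (M : lmodType R) :
  mittag_leffler K M <->
  countably_pure_separable L
    (fun N : lmodType R => countably_generated N /\ mittag_leffler K N) M.
Proof.
split; first exact: mittag_leffler_pure_separable.
by apply: pure_separable_mittag_leffler => // N [].
Qed.
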